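(* Let $S$ and $T$ be dense subsemigroups of $((0,\infty),+)$. Let $A$ be a CR-set near zero in $S$ and let $B$ be a CR-set near zero in $T$. Then $A\times B$ is a CR-set near zero in $S\times T$.
   Context: $\mathcal{P}_f(X)$ denotes the set of finite nonempty subsets of $X$. $S\times T$ carries coordinatewise addition. CR-set near zero in $S$ (for $S$ a dense subsemigroup of $((0,\infty),+)$): let $\mathcal{T}_0$ be the set of all sequences $f:\mathbb{N}\to S$ which converge to $0$ in the usual topology. $A\subseteq S$ is a CR-set near zero in $S$ if for each $k\in\mathbb{N}$ and each $\delta>0$ there exists $r\in\mathbb{N}$ such that whenever $F\in\mathcal{P}_f(\mathcal{T}_0)$ with $|F|\le k$, there exist $a\in S\cap(0,\delta)$ and a nonempty $H\subseteq\{1,2,\ldots,r\}$ such that $a+\sum_{t\in H}f(t)\in A$ for all $f\in F$. The same definition applies to $T$, with sequences in $T$ converging to $0$. CR-set near zero in $S\times T$: let $\mathcal{D}_0$ be the set of all sequences $(x_n,y_n)_{n\in\mathbb{N}}$ in $S\times T$ such that both $x_n$ and $y_n$ converge to $0$ in the usual topology. $D\subseteq S\times T$ is a CR-set near zero in $S\times T$ if for each $k\in\mathbb{N}$ and each $\delta>0$ there exists $r\in\mathbb{N}$ such that for every $F\in\mathcal{P}_f(\mathcal{D}_0)$ with $|F|\le k$ there exist $\overline{a}=(a_1,a_2)\in(S\times T)\cap(0,\delta)^2$ and a nonempty $H\subseteq\{1,2,\ldots,r\}$ such that $\overline{a}+\sum_{t\in H}f(t)\in D$ for all $f\in F$. 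*)

(* Defs.v *)
From HB Require Import structures.
From mathcomp Require Import all_boot all_order all_algebra.
From mathcomp Require Import all_classical all_reals all_analysis.
Set Implicit Arguments.
Unset Strict Implicit.
Unset Printing Implicit Defensive.
Import Order.TTheory GRing.Theory Num.Theory.
Import numFieldNormedType.Exports.
Local Open Scope classical_set_scope.
Local Open Scope ring_scope.

(* Sequences indexed by {1, 2, ...} are represented as functions on [nat], the
   value at [n] being the term of index [n + 1]; accordingly a subset of
   {1, ..., r} is a [{set 'I_r}]. *)

(* Density is with respect to the subspace topology of ]0, +oo[. *)
Definition dense_subsemigroup (R : realType) (S : set R) : Prop :=
  [/\ S `<=` `]0, +oo[,
      forall x y, S x -> S y -> S (x + y)
    & `]0, +oo[ `<=` closure S].

Definition null_seqs (R : realType) (S : set R) : set (nat -> R) :=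
  [set f | (forall n, S (f n)) /\ f @ \oo --> (0 : R)].

Definition null_seqs2 (R : realType) (S T : set R) : set (nat -> R * R) :=
  [set f | [/\ forall n, (S `*` T) (f n),
               (f n).1 @[n --> \oo] --> (0 : R)
             & (f n).2 @[n --> \oo] --> (0 : R)]].

Definition CR_near_zero (R : realType) (S A : set R) : Prop :=
  A `<=` S /\
  forall (k : nat) (delta : R), (0 < k)%N -> 0 < delta ->
  exists2 r : nat, (0 < r)%N &
    forall F : set (nat -> R),
      F `<=` null_seqs S -> F !=set0 -> finite_set F -> (F #<= `I_k)%card ->
    exists (a : R) (H : {set 'I_r}),
      [/\ (S `&` `]0, delta[) a, H != finset.set0
        & forall f, F f -> A (a + \sum_(t in H) f t)].

Definition CR_near_zero2 (R : realType) (S T : set R) (D : set (R * R)) : Prop :=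
  D `<=` S `*` T /\
  forall (k : nat) (delta : R), (0 < k)%N -> 0 < delta ->
  exists2 r : nat, (0 < r)%N &
    forall F : set (nat -> R * R),
      F `<=` null_seqs2 S T -> F !=set0 -> finite_set F -> (F #<= `I_k)%card ->
    exists (a : R * R) (H : {set 'I_r}),
      [/\ ((S `*` T) `&` (`]0, delta[ `*` `]0, delta[)) a, H != finset.set0
        & forall f, F f -> D (a + \sum_(t in H) f t)].

(* Main.v *)
Require Import Defs.
From HB Require Import structures.
From mathcomp Require Import all_boot all_order all_algebra.
From mathcomp Require Import all_classical all_reals all_analysis.
Local Open Scope classical_set_scope.
Import GRing.Theory.
Import numFieldNormedType.Exports.
Local Open Scope ring_scope.

(** Both coordinates must be hit with the same index set, so the two
    hypotheses are used one inside the other.  Let [m] be the bound that the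
    richness of [B] gives for [k], and cut the positions into blocks, the
    [t]-th one holding [t * m], ..., [t * m + m - 1].  For every [f] in [F] and
    every nonempty [K] contained in ['I_m], the sum of the first coordinates of
    [f] over the positions [t * m + n], [n] in [K], is a null sequence in [t].
    There are at most [k * 2 ^ m] of these sequences, so the richness of [A],
    applied to all of them, gives one point [a] and one set [H] of blocks such
    that [a] plus the sum of the first coordinates of [f] over the positions
    [t * m + n] with [t] in [H] and [n] in [K] lies in [A], simultaneously for
    all [f] and all [K].

    With [H] fixed, the sum of the second coordinates of [f] over the positions
    [t * m + n], [t] in [H], is a null sequence in [n]; the richness of [B]
    applied to these at most [k] sequences gives [b] and one [K] in ['I_m].
    Since [A] was prepared for every [K], the point [(a, b)] and the positions
    [t * m + n], with [t] in [H] and [n] in [K], serve both coordinates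
    (lemma [big_grid] turns sums over these positions into double sums). *)

Lemma block_index_subproof (r m : nat) (p : 'I_r * 'I_m) :
  (p.1 * m + p.2 < r * m)%N.
Proof.
case: p => t n /=; apply: (@leq_trans (t.+1 * m)%N).
  by rewrite mulSn addnC ltn_add2r ltn_ord.
by rewrite leq_mul2r ltn_ord orbT.
Qed.

Definition block_index {r m : nat} (p : 'I_r * 'I_m) : 'I_(r * m) :=
  Ordinal (block_index_subproof r m p).

(** Euclidean division by [m] recovers both the block and the offset. *)
Lemma block_index_inj (r m : nat) : injective (@block_index r m).
Proof.
move=> [t n] [t' n'] /(congr1 val) /= E.
have := congr1 (fun x => edivn x m) E.
rewrite !edivn_eq ?ltn_ord// => -[tt' nn'].
by congr pair; apply: val_inj.
Qed.

Definition grid {r m : nat} (H : {set 'I_r}) (K : {set 'I_m}) :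
  {set 'I_(r * m)} := imset block_index (mem (finset.setX H K)).

Lemma grid_neq0 (r m : nat) (H : {set 'I_r}) (K : {set 'I_m}) :
  H != finset.set0 -> K != finset.set0 -> grid H K != finset.set0.
Proof.
move=> /set0Pn[t Ht] /set0Pn[n Kn]; apply/set0Pn.
by exists (block_index (t, n)); apply: imset_f; rewrite finset.in_setX Ht.
Qed.

Lemma big_grid (V : nmodType) {r m : nat} (H : {set 'I_r}) (K : {set 'I_m})
    (g : nat -> V) :
  \sum_(u in grid H K) g u = \sum_(t in H) \sum_(n in K) g (t * m + n)%N.
Proof.
rewrite big_imset /=; last by move=> p q _ _; apply: block_index_inj.
rewrite pair_big /=; apply: eq_bigl => -[t n].
by rewrite finset.in_setX.
Qed.

Lemma null_seqs_comp (R : realType) (S : set R) (f : nat -> R)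
    (h : nat -> nat) :
  (forall n, (n <= h n)%N) -> null_seqs S f -> null_seqs S (f \o h).
Proof.
move=> h_ge [Sf f0]; split=> [n|]; first exact: Sf.
apply: cvg_comp f0; apply/cvgnyPge => N.
exists N => // n /= Nn; exact: leq_trans (h_ge n).
Qed.

Lemma null_seqs_sum (R : realType) (S : set R) (I : finType) (P : {set I})
    (f : I -> nat -> R) :
  (forall x y, S x -> S y -> S (x + y)) -> P != finset.set0 ->
  (forall i, null_seqs S (f i)) ->
  null_seqs S (fun n => \sum_(i in P) f i n).
Proof.
move=> SD /set0Pn[j Pj] f0; split=> [n|].
  (* [S] need not contain 0, so the induction starts from the term of index [j]. *)
  rewrite (bigD1 j)//=; elim/big_rec: _ => [|i x _ Sx].
    by rewrite addr0; apply: (f0 j).1.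
  by rewrite addrCA; apply: SD => //; apply: (f0 i).1.
rewrite [X in _ --> X](_ : 0 = \sum_(i in P) (0 : R)); last by rewrite big1.
by apply: cvg_big => [|i _]; [exact: add_continuous | exact: (f0 i).2].
Qed.

(** Encoding the pair of an element of [F] and an element of [T] by a
    two-digit number in base [#|T|]. *)
Lemma card_le_setX_fin (X : Type) (T : finType) (F : set X) (k : nat)
    (Q : set T) :
  (F #<= `I_k)%card -> (F `*` Q #<= `I_(k * #|T|))%card.
Proof.
move=> /pcard_leP[e].
pose c (p : X * T) : nat := (e p.1 * #|T| + enum_rank p.2)%N.
have c_inj : {in F `*` Q &, injective c}.
  move=> [f x] [g y] /set_mem[/= Ff _] /set_mem[/= Fg _].
  move=> /(congr1 (fun z => edivn z #|T|)).
  rewrite /c !edivn_eq ?ltn_ord//= => -[efg xy].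
  congr pair; first by apply: (@inj _ _ _ e); rewrite ?inE.
  exact/enum_rank_inj/val_inj.
rewrite -(card_le_eql (inj_card_eq c_inj)); apply: subset_card_le.
move=> _ [[f x] [/= Ff _] <-]; rewrite /c /=.
have ef : (e f < k)%N by exact: (@funS _ _ _ _ e).
apply: (@leq_trans ((e f).+1 * #|T|)%N); last by rewrite leq_mul2r ef orbT.
by rewrite mulSn addnC ltn_add2r ltn_ord.
Qed.

Theorem theorem4p4 (R : realType) (S T : set R)
    (hS : dense_subsemigroup S) (hT : dense_subsemigroup T)
    (A B : set R) (hA : CR_near_zero S A) (hB : CR_near_zero T B) :
  CR_near_zero2 S T (A `*` B).
Proof.
case: hS hT hA hB => _ SD _ [_ TD _] [AS richA] [BT richB].
split=> [[x y] [/= Ax By]|k delta k0 d0]; first by split; [exact: AS|exact: BT].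
(* The bound for [B] is chosen first, since the number of sequences handed to
   [A] depends on it. *)
have [m m0 hm] := richB k delta k0 d0.
have N0 : (0 < k * #|{set 'I_m}|)%N.
  by rewrite muln_gt0 k0; apply/card_gt0P; exists finset.set0.
have [r r0 hr] := richA _ delta N0 d0.
exists (r * m)%N; first by rewrite muln_gt0 r0.
move=> F Fnull [f0 Ff0] Ffin Fk.
have null1 f : F f -> null_seqs S (fun n => (f n).1).
  by move=> /Fnull[fST f1 _]; split=> // n; case: (fST n).
have null2 f : F f -> null_seqs T (fun n => (f n).2).
  by move=> /Fnull[fST _ f2]; split=> // n; case: (fST n).
pose phi (p : (nat -> R * R) * {set 'I_m}) (t : nat) : R :=
  \sum_(n in p.2) (p.1 (t * m + n)%N).1.
pose X := F `*` [set K : {set 'I_m} | K != finset.set0].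
have [||||a [H [aS H0 aA]]] := hr (phi @` X).
- move=> _ [[f K] [/= Ff K0] <-]; apply: null_seqs_sum => // n.
  apply: (null_seqs_comp _ _ _ (fun t => t * m + n)%N _ (null1 f Ff)) => t.
  by rewrite -[X in (X <= _)%N]addn0 leq_add// leq_pmulr.
- exists (phi (f0, [set: 'I_m]%SET)), (f0, [set: 'I_m]%SET) => //; split=> //=.
  by apply/set0Pn; exists (Ordinal m0); rewrite finset.in_setT.
- by apply: finite_image; apply: finite_setX.
- by apply: card_le_trans (card_image_le _ _) _; apply: card_le_setX_fin.
(* For [n >= m] the positions [t * m + n] leave the [t]-th block; these terms
   only make [psi f] a full sequence, as [K] lies in ['I_m]. *)
pose psi (f : nat -> R * R) (n : nat) : R := \sum_(t in H) (f (t * m + n)%N).2.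
have [||||b [K [bT K0 bB]]] := hm (psi @` F).
- move=> _ [f Ff <-]; apply: null_seqs_sum => // t.
  by apply: (null_seqs_comp _ _ _ (fun n => t * m + n)%N _ (null2 f Ff)) => n;
    exact: leq_addl.
- by exists (psi f0), f0.
- exact: finite_image.
- by apply: card_le_trans (card_image_le _ _) _.
exists (a, b), (grid H K); split; last 1 first.
- move=> f Ff; rewrite /= big_grid; split => /=.
  + rewrite !raddf_sum /=.
    under eq_bigr do rewrite raddf_sum.
    by apply: (aA (phi (f, K))); exists (f, K).
  + rewrite !raddf_sum /=.
    under eq_bigr do rewrite raddf_sum.
    by rewrite exchange_big /=; apply: (bB (psi f)); exists f.
- by case: aS bT => ? ? [].
- exact: grid_neq0.
Qed.
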